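(* Let $G,H$ be finitely generated groups with $G$ recursively presented, and let $\operatorname{QI}$ be the $G$-subshift encoding quasi-isometries $H\to G$ (for fixed parameters). Let $X\subset A^H$ be a subshift. Then $m(\operatorname{QI}[X])=m(\operatorname{QI})\vee m(X)$.
   Context: Alphabets are finite. For a group $G$ and alphabet $A$, $A^G=\{x\colon G\to A\}$ carries the prodiscrete topology and the shift action $(gx)(h)=x(g^{-1}h)$. A $G$-subshift is a closed $G$-invariant set $X\subset A^G$. Medvedev degrees: for $P,Q\subset\{0,1\}^{\mathbb N}$ write $P\le Q$ if there is a partial computable function $\Psi$ on $\{0,1\}^{\mathbb N}$ (a Turing functional) defined on all of $Q$ with $\Psi(Q)\subset P$. The Medvedev degree $m(P)$ is the class of $P$ under the equivalence $P\le Q\le P$; the degrees form a lattice with supremum $\vee$ and maximum $m(\varnothing)$. For a group $G$ with finite generating set $S$, free group $F(S)$ and canonical epimorphism $\rho\colon F(S)\to G$, the pullback of a subshift $X\subset A^G$ is $\widehat X=\{x\circ\rho: x\in X\}\subset A^{F(S)}$. Via a computable bijection $\mathbb N\to F(S)$ and a fixed-length binary coding of $A$, $\widehat X$ is identified with a subset of $\{0,1\}^{\mathbb N}$, and $m(X):=m(\widehat X)$ (independent of choices). A finitely generated group is recursively presented if the set of words in a finite generating set representing the identity is recursively enumerable. The subshift $\operatorname{QI}$. Let $S,T$ be finite symmetric generating sets containing the identity of $G$ and $H$, with word metrics $d_G,d_H$; let $C,N\ge1$ be integers and $I=\{1,\dots,N\}$. A map $f\colon H\to G$ is a quasi-isometry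 with constant $C$ if $\frac1Cd_H(h,h')-C\le d_G(f(h),f(h'))\le Cd_H(h,h')+C$ for all $h,h'$ and every $g\in G$ is within distance $C$ of $f(H)$. Let $B$ be the set of tuples $b=(b_1,\dots,b_N)$ where each $b_i$ is either the symbol $\ast$ or a map $T\to S^{2C}\times I$ ($S^{2C}$ being the set of words of length $2C$ over $S$). For $q\in B^G$ write $q(g,i)$ for the $i$-th coordinate of $q(g)$. Then $\operatorname{QI}\subset B^G$ is the set of all $q$ encoding some quasi-isometry with constant $C$ and at most $N$ preimages per point, i.e. such that there are a quasi-isometry $f\colon H\to G$ with constant $C$ and a map $\iota\colon H\to I$ with: $h\mapsto(f(h),\iota(h))$ is a bijection from $H$ onto $\{(g,i)\in G\times I: q(g,i)\ne\ast\}$, and for all $h\in H$, $t\in T$, $q(f(h),\iota(h))(t)=(w,j)$ where $w$ represents $f(h)^{-1}f(ht)$ in $G$ and $j=\iota(ht)$. This is a (possibly empty) $G$-subshift. The subshift $\operatorname{QI}[X]$. Enrich the alphabet $B$ by replacing every non-$\ast$ coordinate $b_i$ by pairs $(a,b_i)$ with $a\in A$. $\operatorname{QI}[X]$ is the set of configurations $\widetilde q$ over the enriched alphabet whose $B$-part $q$ lies in $\operatorname{QI}$ and such that, for a pair $(f,\iota)$ encoded by $q$ (that is, a quasi-isometry $f\colon H\to G$ with constant $C$ and a map $\iota\colon H\to I$ such that $h\mapsto(f(h),\iota(h))$ is a bijection from $H$ onto $\{(g,i)\in G\times I: q(g,i)\ne\ast\}$ and, for all $h\in H$, $t\in T$,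 $q(f(h),\iota(h))(t)=(w,j)$ with $w$ representing $f(h)^{-1}f(ht)$ in $G$ and $j=\iota(ht)$), the configuration $h\mapsto$ ($A$-component of $\widetilde q(f(h),\iota(h))$) belongs to $X$ (this does not depend on the choice of $(f,\iota)$, since different choices differ by left translation in $H$). *)

(* Defs.v *)
From HB Require Import structures.
From mathcomp Require Import all_boot all_order all_algebra finmap.
From mathcomp Require Import all_classical topology.

Set Implicit Arguments.
Unset Strict Implicit.
Unset Printing Implicit Defensive.

Import Order.TTheory GRing.Theory Num.Theory.

Local Open Scope classical_set_scope.
Local Open Scope quotient_scope.

(* Programs for the partial recursive functions with an oracle in {0,1}^N.  They
   take an argument list; missing arguments read as 0.  The numerical argument of
   [PSucc], [PQuery], [PPrec] and the searched variable of [PMu] are the head of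
   that list. *)
Inductive program :=
  | PZero
  | PSucc
  | PProj of nat
  | PQuery
  | PComp of program & seq program
  | PPrec of program & program
  | PMu of program.

Definition cantor := nat -> bool.

(* [run o c v y]: the program [c], run on arguments [v] with oracle [o], halts
   with output [y].  In the [PPrec] case, [s] is the sequence of intermediate
   values of the primitive recursion. *)
Fixpoint run (o : cantor) (c : program) (v : seq nat) (y : nat) {struct c} :
    Prop :=
  match c with
  | PZero => y = 0
  | PSucc => y = (head 0 v).+1
  | PProj i => y = nth 0 v i
  | PQuery => y = o (head 0 v)
  | PComp f gs => exists2 w : seq nat,
      (fix evals (gs : seq program) (w : seq nat) : Prop :=
         match gs, w with
         | [::], [::] => True
         | g :: gs', z :: w' => run o g v z /\ evals gs' w'
         | _, _ => False
         end) gs w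
      & run o f w y
  | PPrec f g => exists s : nat -> nat,
      [/\ run o f (behead v) (s 0),
          forall i, i < head 0 v -> run o g (i :: s i :: behead v) (s i.+1)
        & y = s (head 0 v)]
  | PMu f =>
      run o f (y :: v) 0 /\
      forall i, i < y -> exists m, run o f (i :: v) m.+1
  end.

(* A constant oracle adds no computational power. *)
Definition run0 : program -> seq nat -> nat -> Prop := run (fun=> false).

Definition computable (f : nat -> nat) :=
  exists c, forall n, run0 c [:: n] (f n).

Definition recursively_enumerable (E : set nat) :=
  exists c, forall n, E n <-> exists y, run0 c [:: n] y.

Lemma program_ind_nested (P : program -> Prop) :
  P PZero -> P PSucc -> (forall i, P (PProj i)) -> P PQuery ->
  (forall f gs, P f -> foldr (fun g Q => P g /\ Q) True gs -> P (PComp f gs)) ->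
  (forall f g, P f -> P g -> P (PPrec f g)) ->
  (forall f, P f -> P (PMu f)) ->
  forall c, P c.
Proof.
move=> P0 PS Pp Pq Pc Pr Pm; fix IH 1; case=> [||i||f gs|f g|f].
- exact: P0.
- exact: PS.
- exact: Pp.
- exact: Pq.
- apply: Pc; first exact: IH.
  by elim: gs => [|g gs IHgs] /=; [exact: I | split; [exact: IH | exact: IHgs]].
- by apply: Pr; exact: IH.
- by apply: Pm; exact: IH.
Qed.

Lemma run_functional o c v y y' : run o c v y -> run o c v y' -> y = y'.
Proof.
elim/program_ind_nested: c v y y' => [||i||f gs IHf IHgs|f g IHf IHg|f IHf] v y y'
    /=; try by move=> -> ->.
- case=> w hw hy [w' hw' hy'].
  suff E : w = w' by subst w'; exact: IHf hy hy'.
  elim: gs w w' IHgs hw hw' {hy hy'} => [|g gs IH] [|z w] [|z' w'] //=.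
  case=> IHg IHgs [hz hw] [hz' hw'].
  by rewrite (IHg _ _ _ hz hz') (IH _ _ IHgs hw hw').
- case=> s [s0 sS ->] [s' [s0' sS' ->]].
  suff E : forall i, i <= head 0 v -> s i = s' i by exact: E.
  elim=> [_|i IHi lt_i]; first exact: IHf s0 s0'.
  have := sS' _ lt_i; rewrite -IHi; last exact: ltnW.
  by move=> h; exact: IHg (sS _ lt_i) h.
- case=> h0 hlt [h0' hlt']; case: (ltngtP y y') => // lt_y.
  + by have [m hm] := hlt' _ lt_y; have := IHf _ _ _ h0 hm.
  + by have [m hm] := hlt _ lt_y; have := IHf _ _ _ h0' hm.
Qed.

(* [y] is the image of [x] under the Turing functional with program [c], which
   is partial: for a given [x] there is at most one such [y]. *)
Definition maps_to (c : program) (x y : cantor) :=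
  forall n, run x c [:: n] (y n).

Definition medvedev_le (P Q : set cantor) :=
  exists c, forall x, Q x -> exists2 y, P y & maps_to c x y.

Lemma medvedev_le_refl P : medvedev_le P P.
Proof. by exists PQuery => x Px; exists x. Qed.

Fixpoint subst_query (d c : program) : program :=
  match c with
  | PQuery => PComp d [:: PProj 0]
  | PComp f gs => PComp (subst_query d f) (map (subst_query d) gs)
  | PPrec f g => PPrec (subst_query d f) (subst_query d g)
  | PMu f => PMu (subst_query d f)
  | _ => c
  end.

Lemma run_subst_query d x y c v z : maps_to d x y ->
  run y c v z -> run x (subst_query d c) v z.
Proof.
move=> dxy.
elim/program_ind_nested: c v z => [||i||f gs IHf IHgs|f g IHf IHg|f IHf] v z //=.
- by move=> ->; exists [:: nth 0 v 0] => //; rewrite nth0.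
- case=> w hw hz; exists w; last exact: IHf.
  elim: gs w IHgs hw {hz} => [|g gs IH] [|u w] //= [IHg IHgs] [hu hw].
  by split; [exact: IHg | exact: IH].
- case=> s [s0 sS ->]; exists s; split => //; first exact: IHf.
  by move=> i lt_i; apply: IHg; exact: sS.
- case=> h0 hlt; split; first exact: IHf.
  by move=> i /hlt[m hm]; exists m; exact: IHf.
Qed.

Lemma medvedev_le_trans Q P R :
  medvedev_le P Q -> medvedev_le Q R -> medvedev_le P R.
Proof.
move=> [c hc] [d hd]; exists (subst_query d c) => x /hd[y Qy dxy].
have [z Pz cyz] := hc _ Qy; exists z => // n.
exact: run_subst_query dxy (cyz n).
Qed.

Definition medvedev_equiv (P Q : set cantor) : bool :=
  `[< medvedev_le P Q /\ medvedev_le Q P >].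

Lemma medvedev_equiv_refl : reflexive medvedev_equiv.
Proof. by move=> P; apply/asboolP; split; exact: medvedev_le_refl. Qed.

Lemma medvedev_equiv_sym : symmetric medvedev_equiv.
Proof. by move=> P Q; apply/asboolP/asboolP => -[]. Qed.

Lemma medvedev_equiv_trans : transitive medvedev_equiv.
Proof.
move=> Q P R /asboolP[PQ QP] /asboolP[QR RQ]; apply/asboolP; split.
- exact: medvedev_le_trans PQ QR.
- exact: medvedev_le_trans RQ QP.
Qed.

Canonical medvedev_equiv_rel := EquivRel medvedev_equiv
  medvedev_equiv_refl medvedev_equiv_sym medvedev_equiv_trans.

Definition medvedev_degree := {eq_quot medvedev_equiv_rel}.
HB.instance Definition _ := Choice.on medvedev_degree.
HB.instance Definition _ := EqQuotient.on medvedev_degree.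

Definition degree (P : set cantor) : medvedev_degree := \pi_medvedev_degree P.

Lemma degree_eqP P Q :
  degree P = degree Q <-> medvedev_le P Q /\ medvedev_le Q P.
Proof.
split=> [/eqmodP/asboolP//|PQ]; apply/eqmodP; exact/asboolP.
Qed.

Lemma degreeK (a : medvedev_degree) : degree (repr a) = a.
Proof. exact: reprK. Qed.

Definition degree_le (a b : medvedev_degree) : bool :=
  `[< medvedev_le (repr a) (repr b) >].

Lemma degree_leP P Q : reflect (medvedev_le P Q) (degree_le (degree P) (degree Q)).
Proof.
have [PP' P'P] := (degree_eqP (repr (degree P)) P).1 (degreeK _).
have [QQ' Q'Q] := (degree_eqP (repr (degree Q)) Q).1 (degreeK _).
apply: (iffP (asboolP _)) => h.
- exact: medvedev_le_trans P'P (medvedev_le_trans h QQ').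
- exact: medvedev_le_trans PP' (medvedev_le_trans h Q'Q).
Qed.

Lemma degree_le_refl : reflexive degree_le.
Proof. by move=> a; apply/asboolP; exact: medvedev_le_refl. Qed.

Lemma degree_le_anti : antisymmetric degree_le.
Proof.
move=> a b /andP[/asboolP ab /asboolP ba].
by rewrite -[a]degreeK -[b]degreeK; apply/degree_eqP.
Qed.

Lemma degree_le_trans : transitive degree_le.
Proof.
move=> b a c /asboolP ab /asboolP bc; apply/asboolP.
exact: medvedev_le_trans ab bc.
Qed.

Fact medvedev_display : Order.disp_t. Proof. exact: Order.Disp tt tt. Qed.

HB.instance Definition _ := Order.Le_isPOrder.Build medvedev_display
  medvedev_degree degree_le_refl degree_le_anti degree_le_trans.

Definition interleave (x y : cantor) : cantor :=
  fun n => if odd n then y n./2 else x n./2.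

Definition medvedev_join (P Q : set cantor) : set cantor :=
  [set z | exists x y, [/\ P x, Q y & z = interleave x y]].

Section Join.

Let cone := PComp PSucc [:: PZero].
Let cdouble := PPrec PZero (PComp PSucc [:: PComp PSucc [:: PProj 1]]).
Let cneg := PPrec cone PZero.
Let cparity := PPrec PZero (PComp cneg [:: PProj 1]).
(* if the first argument is 0 then the third one, else the second one *)
Let cite := PPrec (PProj 1) (PProj 2).
Let chalf :=
  PPrec PZero (PComp cite
    [:: PComp cparity [:: PProj 0]; PComp PSucc [:: PProj 1]; PProj 1]).

Let eval_double o n : run o cdouble [:: n] n.*2.
Proof.
exists double => /=; split=> // i _.
by exists [:: (i.*2).+1] => //; split => //; exists [:: i.*2].
Qed.

Let eval_neg o (b : bool) : run o cneg [:: nat_of_bool b] (~~ b).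
Proof.
exists (fun n => nat_of_bool (n == 0)); split => //=; last by case: b.
by exists [:: 0].
Qed.

Let eval_parity o n : run o cparity [:: n] (odd n).
Proof.
exists (fun n => nat_of_bool (odd n)); split => //= i _.
by exists [:: nat_of_bool (odd i)] => //; exact: eval_neg.
Qed.

Let eval_ite o (b : bool) y z : run o cite [:: nat_of_bool b; y; z] (if b then y else z).
Proof.
exists (fun n => if n is 0 then z else y); split => //=.
by case: b.
Qed.

Let eval_half o n : run o chalf [:: n] n./2.
Proof.
exists half => /=; split => // i _.
exists [:: nat_of_bool (odd i); (i./2).+1; i./2].
  split; first by exists [:: i] => //; exact: eval_parity.
  by split => //; exists [:: i./2].
have -> : uphalf i = if odd i then (i./2).+1 else i./2.
  by rewrite uphalf_half; case: odd.
exact: eval_ite.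
Qed.

Lemma medvedev_join_lub P Q R :
  medvedev_le (medvedev_join P Q) R <-> medvedev_le P R /\ medvedev_le Q R.
Proof.
split.
- move=> hR; split; apply: medvedev_le_trans hR.
  + exists (PComp PQuery [:: cdouble]) => _ [x [y [Px Qy ->]]]; exists x => // n.
    exists [:: n.*2]; first by split => //; exact: eval_double.
    by rewrite /= /interleave odd_double doubleK.
  + exists (PComp PQuery [:: PComp PSucc [:: cdouble]]) => _ [x [y [Px Qy ->]]].
    exists y => // n; exists [:: (n.*2).+1].
      by split => //; exists [:: n.*2] => //; split => //; exact: eval_double.
    by rewrite /= /interleave /= odd_double /= uphalf_double.
- case=> -[c hc] [d hd].
  exists (PComp cite [:: cparity; PComp d [:: chalf]; PComp c [:: chalf]]) => r Rr.
  have [x Px cx] := hc _ Rr; have [y Qy dy] := hd _ Rr.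
  exists (interleave x y); first by exists x, y.
  move=> n; exists [:: nat_of_bool (odd n); nat_of_bool (y n./2); nat_of_bool (x n./2)].
    split; first exact: eval_parity.
    split; first by exists [:: n./2]; [split => //; exact: eval_half | exact: dy].
    by split => //; exists [:: n./2]; [split => //; exact: eval_half | exact: cx].
  by rewrite /interleave (fun_if nat_of_bool); exact: eval_ite.
Qed.

End Join.

Definition degree_join (a b : medvedev_degree) : medvedev_degree :=
  degree (medvedev_join (repr a) (repr b)).

Lemma degree_joinP (a b c : medvedev_degree) :
  (degree_join a b <= c)%O = ((a <= c) && (b <= c))%O.
Proof.
rewrite -{1}[c]degreeK; apply/degree_leP/andP.
- by move=> /medvedev_join_lub[ac bc]; split; apply/asboolP.
- by move=> [/asboolP ac /asboolP bc]; apply/medvedev_join_lub.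
Qed.

HB.instance Definition _ := Order.POrder_isJoinSemilattice.Build
  medvedev_display medvedev_degree degree_joinP.

Local Open Scope group_scope.

Section Groups.
Variable G : groupType.

Definition eval_letter (S : {fset G}) (l : S * bool) : G :=
  if l.2 then (val l.1)^-1 else val l.1.

(* Words over [S] and the formal inverses of its elements; [(s, true)] stands
   for the inverse of [s]. *)
Definition eval_word (S : {fset G}) (w : seq (S * bool)) : G :=
  \prod_(l <- w) eval_letter l.

Definition generates (S : {fset G}) :=
  forall g, exists w : seq (S * bool), eval_word w = g.

(* Which numbering of the letters is used does not affect computability, since
   the alphabet is finite. *)
Definition word_number (L : finType) (w : seq L) : nat :=
  CodeSeq.code [seq nat_of_ord (enum_rank l) | l <- w].

Definition recursively_presented :=
  exists2 S : {fset G}, generates S &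
    recursively_enumerable
      [set n | exists2 w : seq (S * bool), eval_word w = 1 & word_number w = n].

Definition reduced (S : {fset G}) (w : seq (S * bool)) : bool :=
  sorted (fun l m => ~~ ((l.1 == m.1) && (l.2 != m.2))) w.

(* The free group F(S), as the set of reduced words; only its underlying set and
   the epimorphism onto [G] matter for pullbacks. *)
Definition free_group (S : {fset G}) := {w : seq (S * bool) | reduced w}.

Definition rho (S : {fset G}) (w : free_group S) : G := eval_word (sval w).

(* The choices on which the coding of pullbacks depends: a finite generating set
   together with a computable bijection N -> F(S). *)
Record marking := Marking {
  gens : {fset G};
  gens_generate : generates gens;
  numbering : nat -> free_group gens;
  numbering_bij : bijective numbering;
  numbering_computable :
    computable (fun n => word_number (sval (numbering n)))
}.

Definition shift_by (A : Type) (g : G) (x : G -> A) : G -> A :=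
  fun h => x (g^-1 * h).

Definition subshift (A : finType) (X : set (G -> A)) :=
  closed (X : set {ptws G -> discrete_topology A}) /\
  forall g x, X x -> X (shift_by g x).

End Groups.

Record binary_coding (A : finType) := BinaryCoding {
  coding_length : nat;
  coding_length_gt0 : 0 < coding_length;
  coding :> A -> coding_length.-tuple bool;
  coding_inj : injective coding
}.

(* Bits [n * k, ..., n * k + k - 1], with [k] the length of the coding, are the
   code of the letter of [x] at the [n]-th element of the free group. *)
Definition to_cantor (G : groupType) (p : marking G) (A : finType)
    (c : binary_coding A) (x : free_group (gens p) -> A) : cantor :=
  let k := coding_length c in
  fun n => nth false (c (x (numbering p (n %/ k)))) (n %% k).

Definition pullback (G : groupType) (S : {fset G}) (A : Type)
    (X : set (G -> A)) : set (free_group S -> A) :=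
  [set x \o @rho G S | x in X].
Arguments pullback {G} S {A} X _.

Definition subshift_degree (G : groupType) (p : marking G) (A : finType)
    (c : binary_coding A) (X : set (G -> A)) : medvedev_degree :=
  degree (to_cantor (p := p) c @` pullback (gens p) X).

Definition symmetric_generating_set (G : groupType) (S : {fset G}) :=
  [/\ generates S, 1 \in S & forall s, s \in S -> s^-1 \in S].

Definition spells (G : groupType) (S : {fset G}) (n : nat) (g : G) :=
  exists w : n.-tuple S, \prod_(s <- w) val s = g.

(* Junk value 0 when no word over [S] represents [g]; this does not happen for
   a symmetric generating set. *)
Definition word_length (G : groupType) (S : {fset G}) (g : G) : nat :=
  if pselect (exists n, `[< spells S n g >]) is left e then ex_minn e else 0%N.

Definition word_dist (G : groupType) (S : {fset G}) (g h : G) : nat :=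
  word_length S (g^-1 * h).

Definition quasi_isometry (G H : groupType) (S : {fset G}) (T : {fset H})
    (C : nat) (f : H -> G) :=
  (forall h h',
     let dH : rat := (word_dist T h h')%:R%R in
     let dG : rat := (word_dist S (f h) (f h'))%:R%R in
     (C%:R^-1 * dH - C%:R <= dG /\ dG <= C%:R * dH + C%:R)%R) /\
  (forall g, exists h, (word_dist S g (f h) <= C)%N).

Section QuasiIsometrySubshift.
Variables (G H : groupType) (S : {fset G}) (T : {fset H}) (C N : nat).

Definition qi_map := {ffun T -> (2 * C).-tuple S * 'I_N}.

(* In both alphabets, [None] is the symbol [*]; the index set is {0, ..., N-1}
   instead of {1, ..., N}. *)
Definition qi_alphabet := {ffun 'I_N -> option qi_map}.
Definition qi_enriched_alphabet (A : finType) :=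
  {ffun 'I_N -> option (A * qi_map)}.

Definition encodes (q : G -> qi_alphabet) (f : H -> G) (iota : H -> 'I_N) :=
  [/\ quasi_isometry S T C f,
      set_bij [set: H] [set gi : G * 'I_N | q gi.1 gi.2 != None]
        (fun h => (f h, iota h))
    & forall h (t : T), exists b : qi_map,
        [/\ q (f h) (iota h) = Some b,
            \prod_(s <- (b t).1) val s = (f h)^-1 * f (h * val t)
          & (b t).2 = iota (h * val t)]].

Definition QI : set (G -> qi_alphabet) :=
  [set q | exists f iota, encodes q f iota].

Definition B_part (A : finType) (q : G -> qi_enriched_alphabet A) :
    G -> qi_alphabet :=
  fun g => [ffun i => omap snd (q g i)].

Definition QI_enriched (A : finType) (X : set (H -> A)) :
    set (G -> qi_enriched_alphabet A) :=
  [set q | QI (B_part q) /\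
    exists f iota, encodes (B_part q) f iota /\
      exists2 x : H -> A, X x & forall h, omap fst (q (f h) (iota h)) = Some (x h)].

End QuasiIsometrySubshift.

Arguments QI {G H} S T C N _.
Arguments QI_enriched {G H} S T C N {A} X _.

(* Main.v *)
(* A configuration of QI lets one walk in H: once a cell (g, i) with a non-*
   symbol is fixed, which amounts to choosing h0 in H with (f h0, iota h0) =
   (g, i), reading symbols along a word over T computes f (h0 h) and
   iota (h0 h).  Hence a configuration of QI[X] computes an element of X up to a
   translation, which X absorbs, and it computes its B-part letter by letter.
   Conversely, given q in QI and x in X, the A-component to be put in a non-*
   cell (g, i) is x h for the unique h with (f (h0 h), iota (h0 h)) = (g, i);
   this h is found by walking along all the elements of H, and the test
   f (h0 h) = g is semidecidable because G is recursively presented. *)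
Require Import Defs.
From HB Require Import structures.
From mathcomp Require Import all_boot all_order all_algebra finmap.
From mathcomp Require Import all_classical topology.

Set Implicit Arguments.
Unset Strict Implicit.
Unset Printing Implicit Defensive.

Local Open Scope nat_scope.

(** * Programs for pairs and lists *)

(** A cell is only accessible through an index for [numbering], and several indices may name one
    element. So walking from [f h] to [f (h * t)] already requires an index of a product in [G]; it
    is found by searching for an index together with a certificate of its correctness. Thus the
    recursive presentation serves in both directions, not only to test equality with a given cell.
    In [H] equality is never tested: only words over [T] are followed. A reduction must be total on
    its source, so each search needs a proof that it halts there. For a [*] cell the search for [h]
    would run forever; such cells are recognized beforehand by looking at one letter. Searching also
    needs tests that always halt, so the enumeration of trivial words is replaced by a bounded
    evaluation with decidable certificates. Programs are assembled by closure properties, uniformly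
    in the oracle; whatever depends on finitely many data is a table. *)

Definition consn (n m : nat) : nat := iter n double (m.*2).+1.

(** This is the step of [CodeSeq.code], on which [word_number] rests. As an iterated doubling it is
    a primitive recursion; its values are positive, which leaves 0 for the empty list. *)
Lemma consnE n m : consn n m = 2 ^ n * (m.*2).+1.
Proof.
rewrite /consn; elim: n => [|n IHn]; first by rewrite mul1n.
by rewrite iterS IHn expnS -mul2n mulnA.
Qed.

Definition code_pred := PPrec PZero (PProj 0).
Definition code_double := PPrec PZero (PComp PSucc [:: PComp PSucc [:: PProj 1]]).
Definition code_if := PPrec (PProj 1) (PProj 2).
Definition code_not := PPrec (PComp PSucc [:: PZero]) PZero.
Definition code_odd := PPrec PZero (PComp code_not [:: PProj 1]).
Definition code_half :=
  PPrec PZero (PComp code_if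
    [:: PComp code_odd [:: PProj 0]; PComp PSucc [:: PProj 1]; PProj 1]).
Definition code_consn :=
  PComp (PPrec (PProj 0) (PComp code_double [:: PProj 1]))
    [:: PProj 0; PComp PSucc [:: PComp code_double [:: PProj 1]]].
Definition code_iter_half := PPrec (PProj 0) (PComp code_half [:: PProj 1]).
(** The 2-adic valuation. The outer conditional stops the search at once on 0, which never becomes
    odd by halving. *)
Definition code_head :=
  PMu (PComp code_if
    [:: PProj 1; PComp code_not [:: PComp code_odd [:: code_iter_half]]; PZero]).
Definition code_tail :=
  PComp code_half [:: PComp code_iter_half [:: code_head; PProj 0]].

Lemma run_comp1 o f g v x y :
  run o g v x -> run o f [:: x] y -> run o (PComp f [:: g]) v y.
Proof. by move=> gx fy; exists [:: x]. Qed.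

Lemma run_comp2 o f g1 g2 v x1 x2 y :
  run o g1 v x1 -> run o g2 v x2 -> run o f [:: x1; x2] y ->
  run o (PComp f [:: g1; g2]) v y.
Proof. by move=> gx1 gx2 fy; exists [:: x1; x2]. Qed.

Lemma run_comp3 o f g1 g2 g3 v x1 x2 x3 y :
  run o g1 v x1 -> run o g2 v x2 -> run o g3 v x3 ->
  run o f [:: x1; x2; x3] y ->
  run o (PComp f [:: g1; g2; g3]) v y.
Proof. by move=> gx1 gx2 gx3 fy; exists [:: x1; x2; x3]. Qed.

Lemma run_pred o n : run o code_pred [:: n] n.-1.
Proof. by exists predn. Qed.

Lemma run_double o n : run o code_double [:: n] n.*2.
Proof.
exists double; split=> // i _.
by apply: run_comp1 => //; apply: run_comp1.
Qed.

Lemma run_if o n y z : run o code_if [:: n; y; z] (if n is 0 then z else y).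
Proof. by exists (fun n => if n is 0 then z else y); split. Qed.

Lemma run_not o n : run o code_not [:: n] (n == 0).
Proof.
exists (fun n => nat_of_bool (n == 0)); split=> //=.
by exists [:: 0].
Qed.

Lemma run_odd o n : run o code_odd [:: n] (odd n).
Proof.
exists (fun n => nat_of_bool (odd n)); split=> // i _.
by apply: run_comp1 => //=; case: odd; exact: run_not.
Qed.

Lemma run_half o n : run o code_half [:: n] n./2.
Proof.
exists half; split=> // i _.
apply: run_comp3 => //; first by apply: run_comp1 => //; exact: run_odd.
  exact: run_comp1.
by rewrite /= uphalf_half; case: odd; exact: run_if.
Qed.

Lemma run_consn o n m : run o code_consn [:: n; m] (consn n m).
Proof.
apply: run_comp2 => //.
  by apply: run_comp1 => //; apply: run_comp1 => //; exact: run_double.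
exists (fun i => iter i double (m.*2).+1); split=> // i _.
by apply: run_comp1 => //; exact: run_double.
Qed.

Lemma run_iter_half o n m : run o code_iter_half [:: n; m] (iter n half m).
Proof.
exists (fun i => iter i half m); split=> // i _.
by apply: run_comp1 => //; exact: run_half.
Qed.

Lemma iter_half_double n m : iter n half (iter n double m) = m.
Proof. by elim: n m => // n IHn m; rewrite iterSr iterS doubleK IHn. Qed.

Lemma iter_half_consn i n m : i <= n -> iter i half (consn n m) = consn (n - i) m.
Proof.
by move=> le_in; rewrite /consn -{1}(subnKC le_in) iterD iter_half_double.
Qed.

Lemma consn_gt0 n m : 0 < consn n m.
Proof. by rewrite consnE muln_gt0 expn_gt0. Qed.

Lemma ltn_consn n m : m < consn n m.
Proof.
rewrite consnE; apply: leq_trans (leq_pmull _ _); last by rewrite expn_gt0.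
by rewrite ltnS -addnn leq_addr.
Qed.

Lemma run_head o n m : run o code_head [:: consn n m] n.
Proof.
have E i b : i <= n -> b = odd (consn (n - i) m) ->
    run o (PComp code_if
    [:: PProj 1; PComp code_not [:: PComp code_odd [:: code_iter_half]]; PZero])
    [:: i; consn n m] (~~ b).
  move=> le_in ->; apply: (@run_comp3 _ _ _ _ _ _ _ _ 0) => //.
    apply: run_comp1; last exact: run_not.
    by apply: run_comp1; [exact: run_iter_half | exact: run_odd].
  rewrite iter_half_consn //=; move: (consn_gt0 n m) => /=.
  case: (consn n m) => // k _; case: (odd _); exact: run_if.
split.
  by apply: (E n true) => //; rewrite subnn /= odd_double.
move=> i lt_in; exists 0; apply: (E i false); first exact: ltnW.
by case: (n - i) (subn_gt0 i n) => [|k] /=; rewrite ?lt_in // odd_double.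
Qed.

Lemma run_tail o n m : run o code_tail [:: consn n m] m.
Proof.
apply: run_comp1.
  by apply: run_comp2 => //; [exact: run_head | exact: run_iter_half].
rewrite iter_half_consn // subnn.
by have := run_half o (m.*2).+1; rewrite /= uphalf_double.
Qed.

(** * Effective maps between coded types *)

Definition code_prod (A B : Type) (rA : A -> nat) (rB : B -> nat) (ab : A * B) :=
  consn (rA ab.1) (rB ab.2).

Definition code_seq (A : Type) (rA : A -> nat) : seq A -> nat :=
  foldr (fun a n => consn (rA a) n) 0.

Definition code_fin (F : finType) (x : F) : nat := enum_rank x.

Lemma code_seq_map (A : Type) (rA : A -> nat) s :
  code_seq rA s = CodeSeq.code (map rA s).
Proof. by elim: s => //= a s ->; rewrite consnE mulnC. Qed.

Lemma code_seq_fin (F : finType) : @word_number F =1 code_seq (@code_fin F).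
Proof. by move=> w; rewrite code_seq_map. Qed.

Notation code_nat := (@id nat).
Notation code_bool := nat_of_bool.

Section Effective.

Variable D : set cantor.

(** One program has to work for all oracles in [D], the source of the intended reduction. Its
    behaviour for other oracles, or on numbers that code nothing, is left free. *)
Definition effective (A B : Type) (rA : A -> nat) (rB : B -> nat)
    (f : cantor -> A -> B) :=
  exists c, forall o, D o -> forall a, run o c [:: rA a] (rB (f o a)).

Section Closure.
Variables (A B C : Type) (rA : A -> nat) (rB : B -> nat) (rC : C -> nat).

Lemma effective_ext f g : (forall o, D o -> f o =1 g o) ->
  effective rA rB f -> effective rA rB g.
Proof. by move=> fg [c hc]; exists c => o Do a; rewrite -fg //; exact: hc. Qed.

Lemma effective_comp f g : effective rB rC g -> effective rA rB f ->
  effective rA rC (fun o a => g o (f o a)).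
Proof.
move=> [d hd] [c hc]; exists (PComp d [:: c]) => o Do a.
by apply: run_comp1; [exact: hc | exact: hd].
Qed.

Lemma effective_id : effective rA rA (fun=> id).
Proof. by exists (PProj 0). Qed.

Lemma effective_const b : effective rA rB (fun _ _ => b).
Proof.
suff [c hc] : exists c, forall o v, run o c v (rB b) by exists c.
elim: (rB b) => [|n [c hc]]; first by exists PZero.
by exists (PComp PSucc [:: c]) => o v; apply: run_comp1.
Qed.

Lemma effective_pair f g : effective rA rB f -> effective rA rC g ->
  effective rA (code_prod rB rC) (fun o a => (f o a, g o a)).
Proof.
move=> [c hc] [d hd]; exists (PComp code_consn [:: c; d]) => o Do a.
by apply: run_comp2; [exact: hc | exact: hd | exact: run_consn].
Qed.

Lemma effective_fst f : effective rA (code_prod rB rC) f ->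
  effective rA rB (fun o a => (f o a).1).
Proof.
move=> [c hc]; exists (PComp code_head [:: c]) => o Do a.
by apply: run_comp1; [exact: hc | exact: run_head].
Qed.

Lemma effective_snd f : effective rA (code_prod rB rC) f ->
  effective rA rC (fun o a => (f o a).2).
Proof.
move=> [c hc]; exists (PComp code_tail [:: c]) => o Do a.
by apply: run_comp1; [exact: hc | exact: run_tail].
Qed.

Lemma effective_succ f : effective rA code_nat f ->
  effective rA code_nat (fun o a => (f o a).+1).
Proof.
move=> [c hc]; exists (PComp PSucc [:: c]) => o Do a.
by apply: run_comp1; first exact: hc.
Qed.

Lemma effective_query f : effective rA code_nat f ->
  effective rA code_bool (fun o a => o (f o a)).
Proof.
move=> [c hc]; exists (PComp PQuery [:: c]) => o Do a.
by apply: run_comp1; first exact: hc.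
Qed.

Lemma effective_if b f g : effective rA code_bool b ->
  effective rA rB f -> effective rA rB g ->
  effective rA rB (fun o a => if b o a then f o a else g o a).
Proof.
move=> [c hc] [d hd] [e he]; exists (PComp code_if [:: c; d; e]) => o Do a.
apply: run_comp3; [exact: hc | exact: hd | exact: he |].
by case: (b o a); exact: run_if.
Qed.

(** Both branches are run in every case. This is harmless because the predecessor of 0 is still a
    number, so the program for [g] always receives a valid code. *)
Lemma effective_case_nat n f g : effective rA code_nat n ->
  effective rA rB f -> effective (code_prod rA code_nat) rB g ->
  effective rA rB
    (fun o a => if n o a is m.+1 then g o (a, m) else f o a).
Proof.
move=> [c hc] [d hd] [e he].
exists (PComp code_if [:: c;
    PComp e [:: PComp code_consn [:: PProj 0; PComp code_pred [:: c]]]; d]) => o Do a.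
apply: run_comp3; [exact: hc | | exact: hd |].
  apply: run_comp1; last exact: (he o Do (a, (n o a).-1)).
  apply: run_comp2 => //; last exact: run_consn.
  by apply: run_comp1; [exact: hc | exact: run_pred].
by case: (n o a) => [|m]; exact: run_if.
Qed.

(* The program for the nonempty case must not be run on the empty list, whence
   a recursion of length at most one rather than [code_if]. *)
Lemma effective_case_seq s f g : effective rA (code_seq rC) s ->
  effective rA rB f ->
  effective (code_prod rA (code_prod rC (code_seq rC))) rB g ->
  effective rA rB
    (fun o a => if s o a is x :: t then g o (a, (x, t)) else f o a).
Proof.
move=> [c hc] [d hd] [e he].
exists (PComp (PPrec (PComp d [:: PProj 1])
      (PComp e [:: PComp code_consn [:: PProj 3; PProj 2]]))
    [:: PComp code_not [:: PComp code_not [:: c]]; c; PProj 0]) => o Do a.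
apply: run_comp3 => //; [|exact: hc|].
  apply: run_comp1; last exact: run_not.
  by apply: run_comp1; [exact: hc | exact: run_not].
exists (fun n => if n is 0 then rB (f o a)
  else rB (if s o a is x :: t then g o (a, (x, t)) else f o a)); split.
- by apply: run_comp1 => //; exact: hd.
- case: (s o a) => [|x t] i; first by rewrite ltn0.
  rewrite [code_seq _ _]/= (gtn_eqF (consn_gt0 _ _)) ltnS leqn0 => /eqP->.
  apply: run_comp1; last exact: (he o Do (a, (x, t))).
  by apply: run_comp2 => //; exact: run_consn.
- case: (s o a) => [|x t] //.
  by rewrite [code_seq _ _]/= (gtn_eqF (consn_gt0 _ _)).
Qed.

Lemma effective_iteri n f g : effective rA code_nat n -> effective rA rB f ->
  effective (code_prod rA (code_prod code_nat rB)) rB g ->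
  effective rA rB
    (fun o a => iteri (n o a) (fun i b => g o (a, (i, b))) (f o a)).
Proof.
move=> [c hc] [d hd] [e he].
exists (PComp (PPrec d
      (PComp e [:: PComp code_consn [:: PProj 2;
         PComp code_consn [:: PProj 0; PProj 1]]]))
    [:: c; PProj 0]) => o Do a.
apply: run_comp2 => //; first exact: hc.
exists (fun k => rB (iteri k (fun i b => g o (a, (i, b))) (f o a))).
split=> [|i _|] //; first exact: hd.
apply: run_comp1; last exact: he.
apply: run_comp2 => //; last exact: run_consn.
by apply: run_comp2 => //; exact: run_consn.
Qed.

(** The coding of [B] must be onto: the minimization tries every number in turn, and the program for
    [p] is only known to halt on codes. *)
Lemma effective_search (dB : nat -> B) p : cancel dB rB -> cancel rB dB ->
  effective (code_prod rA rB) code_bool p ->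
  (forall o, D o -> forall a, exists b, p o (a, b)) ->
  exists2 f, effective rA rB f & forall o, D o -> forall a, p o (a, f o a).
Proof.
move=> dBK rBK [c hc] exp.
pose f o a := if pselect (exists n, p o (a, dB n)) is left e
  then dB (ex_minn e) else dB 0.
have fP o (Do : D o) a : exists2 n, f o a = dB n &
    p o (a, dB n) /\ forall i, i < n -> ~~ p o (a, dB i).
  rewrite /f; case: pselect => [e|]; last first.
    by case: (exp o Do a) => b pb []; exists (rB b); rewrite rBK.
  case: ex_minnP => n pn minn; exists n => //; split=> // i lt_in.
  by apply: contraL lt_in => pi; rewrite -leqNgt minn.
exists f; last by move=> o Do a; have [n -> []] := fP o Do a.
exists (PComp (PMu (PComp code_not
    [:: PComp c [:: PComp code_consn [:: PProj 1; PProj 0]]])) [:: PProj 0]).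
move=> o Do a; have [n -> [pn minn]] := fP o Do a.
have E i : run o (PComp code_not
    [:: PComp c [:: PComp code_consn [:: PProj 1; PProj 0]]])
    [:: i; rA a] (~~ p o (a, dB i)).
  apply: (@run_comp1 _ _ _ _ (p o (a, dB i))); last first.
    by case: (p o _); exact: run_not.
  apply: run_comp1; last exact: hc.
  by apply: run_comp2 => //; rewrite /code_prod /= dBK; exact: run_consn.
apply: (@run_comp1 _ _ _ _ (rA a)) => //; rewrite dBK; split.
  by have := E n; rewrite pn; exact.
by move=> i /minn pi; exists 0; have := E i; rewrite pi; exact.
Qed.

End Closure.
End Effective.

Section DerivedClosure.
Variables (D : set cantor) (A B : Type) (rA : A -> nat) (rB : B -> nat).

(** The fold is a bounded iteration on pairs of a remaining list and an accumulator. The code of the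
    list bounds its length and serves as the number of rounds; surplus rounds idle on the empty
    list. *)
Lemma effective_foldl (X : Type) (rX : X -> nat) s z st :
  effective D rA (code_seq rX) s -> effective D rA rB z ->
  effective D (code_prod rA (code_prod rB rX)) rB st ->
  effective D rA rB
    (fun o a => foldl (fun b x => st o (a, (b, x))) (z o a) (s o a)).
Proof.
move=> effs effz effst.
pose step o (y : A * (nat * (seq X * B))) : seq X * B :=
  if y.2.2.1 is x :: t then (t, st o (y.1, (y.2.2.2, x))) else ([::], y.2.2.2).
have effstep : effective D (code_prod rA (code_prod code_nat
    (code_prod (code_seq rX) rB))) (code_prod (code_seq rX) rB) step.
  have eff22 : effective D (code_prod rA (code_prod code_nat
    (code_prod (code_seq rX) rB))) (code_prod (code_seq rX) rB)
    (fun o y => y.2.2).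
    by do 2! apply: effective_snd; exact: effective_id.
  pose u o (y : A * (nat * (seq X * B)) * (X * seq X)) :=
    (y.2.2, st o (y.1.1, (y.1.2.2.2, y.2.1))).
  apply: (@effective_case_seq D _ _ X _ _ rX (fun o y => y.2.2.1)
    (fun o y => ([::], y.2.2.2)) u).
  - exact: effective_fst eff22.
  - apply: effective_pair; first exact: effective_const.
    exact: effective_snd eff22.
  - apply: effective_pair.
      by do 2! apply: effective_snd; exact: effective_id.
    apply: (effective_comp effst); apply: effective_pair.
      by do 2! apply: effective_fst; exact: effective_id.
    apply: effective_pair; last first.
      by apply: effective_fst; apply: effective_snd; exact: effective_id.
    by do 3! apply: effective_snd; apply: effective_fst; exact: effective_id.
have effn : effective D rA code_nat (fun o a => code_seq rX (s o a)).
  by case: effs => c hc; exists c.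
have := effective_snd (effective_iteri effn (effective_pair effs effz) effstep).
apply: effective_ext => o Do a.
set n := code_seq rX (s o a).
have : size (s o a) <= n.
  rewrite {}/n; elim: (s o a) => //= x t IHt.
  exact: leq_ltn_trans IHt (ltn_consn _ _).
pose g := fun y => step o (a, (0, y)).
have -> y : iteri n (fun i y => step o (a, (i, y))) y = iter n g y.
  by elim: {+}n => //= k ->.
elim: n (s o a) (z o a) => [|n IHn] [|x t] b //= le_tn; rewrite -iterS iterSr.
  exact: (IHn [::]).
exact: IHn.
Qed.

(** No uniformity in [x] is asked of the family [h]: its finitely many programs are joined by nested
    conditionals on the rank of [f o a]. In particular every function on a finite type is
    effective. *)
Lemma effective_finite (F : finType) (f : cantor -> A -> F)
    (h : F -> cantor -> A -> B) :
  effective D rA (@code_fin F) f -> (forall x, effective D rA rB (h x)) ->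
  effective D rA rB (fun o a => h (f o a) o a).
Proof.
(* If [F] is empty then so is [A] whenever some oracle lies in [D], and any program will do. *)
move=> [c hc] effh; have [x0 _|F0] := pickP (@predT F); last first.
  by exists PZero => o Do a; have := F0 (f o a).
suff [d hd] : exists d, forall o, D o -> forall a j,
    run o d [:: j; rA a] (rB (h (nth x0 (enum F) j) o a)).
  exists (PComp d [:: c; PProj 0]) => o Do a.
  apply: run_comp2; [exact: hc | by [] |].
  by have := hd o Do a (enum_rank (f o a)); rewrite nth_enum_rank; exact.
elim: (enum F) => [|x s [d hd]].
  have [d hd] := effh x0; exists (PComp d [:: PProj 1]) => o Do a j.
  by apply: run_comp1 => //; rewrite nth_nil; exact: hd.
have [e he] := effh x; exists (PComp code_if [:: PProj 0;
  PComp d [:: PComp code_pred [:: PProj 0]; PProj 1]; PComp e [:: PProj 1]]).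
move=> o Do a j.
apply: (@run_comp3 _ _ _ _ _ _ j (rB (h (nth x0 s j.-1) o a)) (rB (h x o a))) => //.
- apply: run_comp2 => //; last exact: hd.
  by apply: run_comp1 => //; exact: run_pred.
- by apply: run_comp1 => //; exact: he.
- by case: j => [|j]; exact: run_if.
Qed.

Lemma effective_fin (F : finType) (f : cantor -> A -> F) (h : F -> B) :
  effective D rA (@code_fin F) f -> effective D rA rB (fun o a => h (f o a)).
Proof.
move=> efff; apply: (effective_finite (h := fun x _ _ => h x) efff) => x.
exact: effective_const.
Qed.

(** The function [g] can be arbitrary: the list [s] is fixed, so only finitely many lists of values
    occur, and they are distinguished one entry at a time. *)
Lemma effective_fin_map (I : Type) (s : seq I) (F : finType)
    (f : I -> cantor -> A -> F) (g : seq F -> B) :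
  (forall i, effective D rA (@code_fin F) (f i)) ->
  effective D rA rB (fun o a => g [seq f i o a | i <- s]).
Proof.
move=> efff; elim: s g => [|i s IHs] g /=; first exact: effective_const.
apply: (effective_finite (h := fun x o a => g (x :: [seq f i o a | i <- s])) (efff i)).
by move=> x; exact: (IHs (fun w => g (x :: w))).
Qed.

Lemma effective_nth (C : Type) (rC : C -> nat) c0 s i :
  effective D rA (code_seq rC) s -> effective D rA rC (fun o a => nth c0 (s o a) i).
Proof.
elim: i s => [|i IHi] s effs.
  have := effective_case_seq effs (effective_const D rA rC c0)
    (effective_fst (effective_snd (effective_id D _))).
  by apply: effective_ext => o Do a /=; case: (s o a).
have effb : effective D rA (code_seq rC) (fun o a => behead (s o a)).
  have := effective_case_seq effs (effective_const D rA (code_seq rC) [::])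
    (effective_snd (effective_snd (effective_id D _))).
  by apply: effective_ext => o Do a /=; case: (s o a).
by have := IHi _ effb; apply: effective_ext => o Do a; rewrite nth_behead.
Qed.

End DerivedClosure.

Section ListsAndNumbers.
Variable D : set cantor.

Lemma effective_cons (A : Type) (rA : A -> nat) (X : Type) (rX : X -> nat) x s :
  effective D rA rX x -> effective D rA (code_seq rX) s ->
  effective D rA (code_seq rX) (fun o a => x o a :: s o a).
Proof. by move=> effx effs; have [c hc] := effective_pair effx effs; exists c. Qed.

Lemma effective_catrev (A : Type) (rA : A -> nat) (X : Type) (rX : X -> nat) s t :
  effective D rA (code_seq rX) s -> effective D rA (code_seq rX) t ->
  effective D rA (code_seq rX) (fun o a => catrev (s o a) (t o a)).
Proof.
move=> effs efft.
have := effective_foldl effs efft (effective_cons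
  (effective_snd (effective_snd (effective_id D _)))
  (effective_fst (effective_snd (effective_id D _)))).
apply: effective_ext => o Do a /=.
by elim: (s o a) (t o a) => //= x u IHu w; rewrite IHu.
Qed.

Lemma effective_cat (A : Type) (rA : A -> nat) (X : Type) (rX : X -> nat) s t :
  effective D rA (code_seq rX) s -> effective D rA (code_seq rX) t ->
  effective D rA (code_seq rX) (fun o a => s o a ++ t o a).
Proof.
move=> effs efft.
have effrev := effective_catrev effs (effective_const D rA (code_seq rX) [::]).
have := effective_catrev effrev efft.
by apply: effective_ext => o Do a; rewrite -/(rev _) catrevE revK.
Qed.

Lemma effective_flatten_map (A : Type) (rA : A -> nat) (L : finType) (X : Type) (rX : X -> nat)
    (f : L -> seq X) s :
  effective D rA (code_seq (@code_fin L)) s ->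
  effective D rA (code_seq rX) (fun o a => flatten [seq f l | l <- s o a]).
Proof.
move=> effs.
have effst : effective D (code_prod rA (code_prod (code_seq rX) (@code_fin L)))
    (code_seq rX) (fun o y => y.2.1 ++ f y.2.2).
  apply: effective_cat.
    by apply: effective_fst; apply: effective_snd; exact: effective_id.
  by apply: effective_fin; do 2! apply: effective_snd; exact: effective_id.
have := effective_foldl effs (effective_const D rA (code_seq rX) [::]) effst.
apply: effective_ext => o Do a /=; rewrite -[RHS]cat0s.
by elim: (s o a) [::] => [|l u IHu] w /=; rewrite ?cats0 // IHu catA.
Qed.

Lemma effective_add (A : Type) (rA : A -> nat) m n :
  effective D rA code_nat m -> effective D rA code_nat n ->
  effective D rA code_nat (fun o a => m o a + n o a).
Proof.
move=> effm effn.
have := effective_iteri effm effn (effective_succ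
  (effective_snd (effective_snd (effective_id D _)))).
apply: effective_ext => o Do a.
by elim: (m o a) => //= k ->.
Qed.

Lemma effective_mul (A : Type) (rA : A -> nat) m n :
  effective D rA code_nat m -> effective D rA code_nat n ->
  effective D rA code_nat (fun o a => m o a * n o a).
Proof.
move=> effm effn.
have := effective_iteri effm (effective_const D rA code_nat 0)
  (effective_add (effective_comp effn (effective_fst (effective_id D _)))
    (effective_snd (effective_snd (effective_id D _)))).
apply: effective_ext => o Do a.
by elim: (m o a) => //= k ->; rewrite mulSn.
Qed.

(* The remainder is carried along as an element of ['I_k.+1], so that the test
   deciding whether it wraps around is a finite table. *)
Lemma effective_divmod (A : Type) (rA : A -> nat) k n : effective D rA code_nat n ->
  effective D rA (code_prod code_nat (@code_fin 'I_k.+1))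
    (fun o a => (n o a %/ k.+1, inord (n o a %% k.+1))).
Proof.
move=> effn.
have eff22 : effective D (code_prod rA (code_prod code_nat
    (code_prod code_nat (@code_fin 'I_k.+1)))) (code_prod code_nat (@code_fin 'I_k.+1))
    (fun o y => y.2.2).
  by do 2! apply: effective_snd; exact: effective_id.
have effg : effective D (code_prod rA (code_prod code_nat
    (code_prod code_nat (@code_fin 'I_k.+1)))) (code_prod code_nat (@code_fin 'I_k.+1))
    (fun _ y => if y.2.2.2 == ord_max then (y.2.2.1.+1, ord0)
                else (y.2.2.1, inord (y.2.2.2).+1)).
  apply: effective_if.
  - exact: (effective_fin _ (fun i => i == ord_max) (effective_snd eff22)).
  - apply: effective_pair; last exact: effective_const.
    by apply: effective_succ; exact: effective_fst eff22.
  - apply: effective_pair; first exact: effective_fst eff22.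
    exact: (effective_fin _ (fun i : 'I_k.+1 => inord i.+1) (effective_snd eff22)).
have := effective_iteri effn (effective_const D rA
  (code_prod code_nat (@code_fin 'I_k.+1)) (0, ord0)) effg.
apply: effective_ext => o Do a.
elim: (n o a) => [|m IHm] /=.
  by rewrite div0n mod0n; congr pair; apply: val_inj; rewrite /= inordK.
rewrite {}IHm /= divnS // modnS -val_eqE /= inordK ?ltn_pmod //.
have -> : (k.+1 %| m.+1) = (m %% k.+1 == k).
  rewrite /dvdn -addn1 -modnDml addn1.
  have := ltn_pmod m (ltn0Sn k); rewrite ltnS leq_eqVlt => /orP[/eqP->|lt_mk].
    by rewrite modnn !eqxx.
  by rewrite modn_small // (ltn_eqF lt_mk).
case: eqP => _ //; congr pair; apply: val_inj.
by rewrite /= inordK.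
Qed.

End ListsAndNumbers.

(** * Bounded evaluation and semidecidability *)

Definition prec_step (f : nat -> nat -> nat) (i r : nat) : nat :=
  if r is x.+1 then f i x else 0.

(* States: [0] still searching, [1] blocked by an unfinished computation,
   [y.+2] found [y]. *)
Definition mu_step (f : nat -> nat) (i r : nat) : nat :=
  if r is 0 then match f i with 0 => 1 | 1 => i.+2 | _ => 0 end else r.

(* [0] means that the computation with a constant oracle has not succeeded
   within the bound [s], and [y.+1] that its output is [y]. *)
Fixpoint bounded_run (c : program) (s : nat) (v : seq nat) : nat :=
  match c with
  | PZero | PQuery => 1
  | PSucc => (head 0 v).+2
  | PProj i => (nth 0 v i).+1
  | PComp f gs =>
      if all (fun g => bounded_run g s v != 0) gs
      then bounded_run f s [seq (bounded_run g s v).-1 | g <- gs] else 0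
  | PPrec f g =>
      iteri (head 0 v) (prec_step (fun i x => bounded_run g s (i :: x :: behead v)))
        (bounded_run f s (behead v))
  | PMu f =>
      (iteri s (mu_step (fun i => bounded_run f s (i :: v))) 0).-1
  end.

Lemma bounded_run_sound c s v y : bounded_run c s v = y.+1 -> run0 c v y.
Proof.
elim/program_ind_nested: c v y => [||i||f gs IHf IHgs|f g IHf IHg|f IHf] v y /=.
- by case.
- by case.
- by case.
- by case.
- case: ifP => // allgs /IHf hf.
  exists [seq (bounded_run g s v).-1 | g <- gs] => // {hf}.
  elim: gs IHgs allgs => //= g gs IH [IHg IHgs] /andP[]; case E : bounded_run => [//|z] _ allgs.
  by split; [exact: IHg | exact: IH].
- pose r n := iteri n (prec_step (fun i x => bounded_run g s (i :: x :: behead v)))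
    (bounded_run f s (behead v)).
  rewrite -[LHS]/(r (head 0 v)) => rv.
  (* Failure is absorbing for [prec_step], so success at the end forces success at all earlier
     stages. *)
  have rpos i : i <= head 0 v -> (r i).-1.+1 = r i.
    move=> le_iv; rewrite prednK // lt0n; apply/eqP => ri0.
    suff : r (head 0 v) = 0 by rewrite rv.
    rewrite -(subnK le_iv); elim: (_ - i) => //= k.
    by rewrite -/(r _) => ->.
  exists (fun i => (r i).-1); split; last by rewrite rv.
    by apply: IHf; rewrite -[LHS]/(r 0) rpos.
  move=> i lt_iv; apply: IHg.
  have := rpos _ (ltnW lt_iv); have := rpos _ lt_iv.
  by rewrite {1 2}[r i.+1]/r /= -/(r i); case: (r i).
- pose r n := iteri n (mu_step (fun i => bounded_run f s (i :: v))) 0.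
  rewrite -[X in X.-1]/(r s) => rs.
  (* The blocked state claims nothing: passing over an undecided index could produce an output that
     is not the minimum. *)
  have : forall n, match r n with
      | 0 => forall i, i < n -> exists m, run0 f (i :: v) m.+1
      | 1 => True
      | y.+2 => run0 f (y :: v) 0 /\ forall i, i < y -> exists m, run0 f (i :: v) m.+1
      end.
    elim=> // n; rewrite [r n.+1]/r /= -/(r n); case: (r n) => [IHn|k]; last exact.
    rewrite /mu_step; case E : bounded_run => [//|[|m]].
      by split=> //; exact: IHf.
    move=> i; rewrite ltnS leq_eqVlt => /orP[/eqP->|/IHn//].
    by exists m; exact: IHf.
  by move=> /(_ s); case: (r s) rs => [//|[//|k]] /= [->].
Qed.

(** Gives one bound for all the subcomputations of a recursion or a minimization, whose number
    depends on the input. *)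
Lemma eventually_forall (P : nat -> nat -> Prop) n :
  (forall i, i < n -> exists s, forall s', s <= s' -> P i s') ->
  exists s, forall s', s <= s' -> forall i, i < n -> P i s'.
Proof.
elim: n => [|n IHn] evP; first by exists 0.
have [s hs] := IHn (fun i lt_in => evP i (ltnW lt_in)).
have [t ht] := evP n (ltnSn n).
exists (maxn s t) => s'; rewrite geq_max => /andP[le_ss' le_ts'] i.
by rewrite ltnS leq_eqVlt => /orP[/eqP->|]; [exact: ht | exact: hs].
Qed.

(** The bound limits only the range of minimizations. Success for all larger bounds is built into
    the statement so that bounds of subcomputations combine by [maxn]. *)
Lemma bounded_run_complete c v y : run0 c v y ->
  exists s, forall s', s <= s' -> bounded_run c s' v = y.+1.
Proof.
elim/program_ind_nested: c v y => [||i||f gs IHf IHgs|f g IHf IHg|f IHf] v y /=.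
- by move=> ->; exists 0.
- by move=> ->; exists 0.
- by move=> ->; exists 0.
- by move=> ->; exists 0.
- case=> w hw /IHf[t ht].
  have [s hs] : exists s, forall s', s <= s' ->
      all (fun g => bounded_run g s' v != 0) gs /\
      [seq (bounded_run g s' v).-1 | g <- gs] = w.
    elim: gs w IHgs hw {ht} => [|g gs IH] [|z w] //=; first by exists 0.
    case=> IHg IHgs [/IHg[s hs] /(IH _ IHgs)[u hu]].
    exists (maxn s u) => s'; rewrite geq_max => /andP[/hs-> /hu[-> ->]].
    by [].
  exists (maxn s t) => s'; rewrite geq_max => /andP[/hs[-> ->]]; exact: ht.
- case=> r [/IHf[t ht] hr ->].
  have [s hs] := eventually_forall (fun i lt_i => IHg _ _ (hr i lt_i)).
  exists (maxn s t) => s'; rewrite geq_max => /andP[/hs{}hs /ht{}ht].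
  have : head 0 v <= head 0 v by [].
  elim: {-2}(head 0 v) => //= i IHi lt_iv.
  by rewrite IHi ?(ltnW lt_iv) //; exact: hs.
- case=> /IHf[t ht] hlt.
  have [s hs] := @eventually_forall
    (fun i s => exists m, bounded_run f s (i :: v) = m.+2) y (fun i lt_i =>
    let: ex_intro m hm := hlt i lt_i in let: ex_intro s hs := IHf _ _ hm in
    ex_intro _ s (fun s' le_s => ex_intro _ m (hs s' le_s))).
  (* Index [y] is inspected in round [y.+1]. *)
  exists (maxn y.+1 (maxn s t)) => s'; rewrite !geq_max.
  case/andP=> lt_ys' /andP[/hs{}hs /ht{}ht].
  pose r n := iteri n (mu_step (fun i => bounded_run f s' (i :: v))) 0.
  rewrite -[X in X.-1]/(r s').
  have r0 i : i <= y -> r i = 0.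
    elim: i => // i IHi lt_iy; rewrite [r _]/r /= -/(r i) IHi ?(ltnW lt_iy) //.
    by rewrite /mu_step; have [m ->] := hs _ lt_iy.
  suff -> : r s' = y.+2 by [].
  rewrite -(subnK lt_ys'); elim: (s' - _) => [|k].
    by rewrite [r _]/r /= -/(r y) r0 // /mu_step ht.
  by rewrite [r _]/r /= -/(r _) => ->.
Qed.

Section BoundedRun.
Variable D : set cantor.

Let effective_arg c : effective D (code_prod code_nat (code_seq code_nat)) code_nat
    (fun _ y => bounded_run c y.1 y.2) ->
  forall (A : Type) (rA : A -> nat) s v,
  effective D rA code_nat s -> effective D rA (code_seq code_nat) v ->
  effective D rA code_nat (fun o a => bounded_run c (s o a) (v o a)).
Proof. move=> effc A rA s v effs effv; exact: effective_comp effc (effective_pair effs effv). Qed.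

(** The program [c] is fixed and not an input, so induction on [c] replaces a universal program. *)
Lemma effective_bounded_run c : effective D
  (code_prod code_nat (code_seq code_nat)) code_nat
  (fun _ y => bounded_run c y.1 y.2).
Proof.
have eff1 : effective D (code_prod code_nat (code_seq code_nat)) code_nat
  (fun _ y => y.1) := effective_fst (effective_id D _).
have eff2 : effective D (code_prod code_nat (code_seq code_nat)) (code_seq code_nat)
  (fun _ y => y.2) := effective_snd (effective_id D _).
have effb : effective D (code_prod code_nat (code_seq code_nat)) (code_seq code_nat)
    (fun _ y => behead y.2).
  have := effective_case_seq eff2 (effective_const D _ (code_seq code_nat) [::])
    (effective_snd (effective_snd (effective_id D _))).
  by apply: effective_ext => o Do [s [|x v]].
elim/program_ind_nested: c => [||i||f gs IHf IHgs|f g IHf IHg|f IHf].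
- exact: effective_const.
- by do 2! apply: effective_succ; exact: (effective_nth 0 0 eff2).
- by apply: effective_succ; exact: effective_nth.
- exact: effective_const.
- have effall : effective D (code_prod code_nat (code_seq code_nat)) code_bool
      (fun _ y => all (fun g => bounded_run g y.1 y.2 != 0) gs).
    elim: gs IHgs => [|g gs IH] [] /=; first by move=> *; exact: effective_const.
    move=> effg /IH effgs.
    have := effective_case_nat effg (effective_const D _ code_bool false)
      (effective_comp effgs (effective_fst (effective_id D _))).
    by apply: effective_ext => o Do y /=; case: bounded_run.
  have effmap : effective D (code_prod code_nat (code_seq code_nat)) (code_seq code_nat)
      (fun _ y => [seq (bounded_run g y.1 y.2).-1 | g <- gs]).
    elim: gs IHgs {effall} => [|g gs IH] [] /=; first by move=> *; exact: effective_const.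
    move=> effg /IH effgs; apply: effective_cons effgs.
    have := effective_case_nat effg (effective_const D _ code_nat 0)
      (effective_snd (effective_id D _)).
    by apply: effective_ext => o Do y /=; case: bounded_run.
  apply: effective_if effall _ (effective_const _ _ _ _).
  exact: effective_arg IHf _ _ _ _ eff1 effmap.
- have effr : effective D (code_prod (code_prod code_nat (code_seq code_nat))
      (code_prod code_nat code_nat)) code_nat (fun _ y => y.2.2).
    by do 2! apply: effective_snd; exact: effective_id.
  have effy : effective D (code_prod (code_prod (code_prod code_nat (code_seq code_nat))
      (code_prod code_nat code_nat)) code_nat) (code_prod code_nat (code_seq code_nat))
      (fun _ y => y.1.1).
    by do 2! apply: effective_fst; exact: effective_id.
  have effg : effective D (code_prod (code_prod (code_prod code_nat (code_seq code_nat))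
      (code_prod code_nat code_nat)) code_nat) code_nat
      (fun _ y => bounded_run g y.1.1.1 (y.1.2.1 :: y.2 :: behead y.1.1.2)).
    apply: (effective_arg IHg); first exact: effective_fst effy.
    apply: effective_cons.
      by apply: effective_fst; apply: effective_snd; apply: effective_fst; exact: effective_id.
    apply: effective_cons; first by apply: effective_snd; exact: effective_id.
    exact: effective_comp effb effy.
  have := effective_iteri (effective_nth 0 0 eff2) (effective_arg IHf eff1 effb)
    (effective_case_nat effr (effective_const D _ _ 0) effg).
  by apply: effective_ext => o Do y; rewrite nth0.
- have effr : effective D (code_prod (code_prod code_nat (code_seq code_nat))
      (code_prod code_nat code_nat)) code_nat (fun _ y => y.2.2).
    by do 2! apply: effective_snd; exact: effective_id.
  have effi : effective D (code_prod (code_prod code_nat (code_seq code_nat))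
      (code_prod code_nat code_nat)) code_nat (fun _ y => y.2.1).
    by apply: effective_fst; apply: effective_snd; exact: effective_id.
  have effy : effective D (code_prod (code_prod code_nat (code_seq code_nat))
      (code_prod code_nat code_nat)) (code_prod code_nat (code_seq code_nat)) (fun _ y => y.1).
    by apply: effective_fst; exact: effective_id.
  have efff : effective D (code_prod (code_prod code_nat (code_seq code_nat))
      (code_prod code_nat code_nat)) code_nat
      (fun _ y => bounded_run f y.1.1 (y.2.1 :: y.1.2)).
    apply: (effective_arg IHf); first exact: effective_fst effy.
    by apply: effective_cons => //; exact: effective_snd effy.
  have effm := effective_case_nat efff (effective_const D _ code_nat 1)
    (effective_case_nat (effective_snd (effective_id D _))
      (effective_comp (effective_succ (effective_succ effi)) (effective_fst (effective_id D _)))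
      (effective_const D _ code_nat 0)).
  have effst : effective D (code_prod (code_prod code_nat (code_seq code_nat))
      (code_prod code_nat code_nat)) code_nat
      (fun _ y => mu_step (fun i => bounded_run f y.1.1 (i :: y.1.2)) y.2.1 y.2.2).
    have := effective_case_nat effr effm
      (effective_comp effr (effective_fst (effective_id D _))).
    by apply: effective_ext => o Do [[s v] [i [|r]]].
  have effs := effective_iteri eff1 (effective_const D _ code_nat 0) effst.
  have := effective_case_nat effs (effective_const D _ code_nat 0)
      (effective_snd (effective_id D _)).
  by apply: effective_ext => o Do [s v] /=; case: (iteri _ _ _).
Qed.

(* Dovetailing: the certificate [s] bounds the resources of the computation. *)
Lemma recursively_enumerable_projection E : recursively_enumerable E ->
  exists2 e : nat * nat -> bool,
    effective D (code_prod code_nat code_nat) code_bool (fun=> e)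
    & forall n, E n <-> exists s, e (n, s).
Proof.
case=> c Ec; exists (fun ns => bounded_run c ns.2 [:: ns.1] != 0).
  have := effective_case_nat (effective_arg (effective_bounded_run c)
      (effective_snd (effective_id D _))
      (effective_cons (effective_fst (effective_id D _))
        (effective_const D _ (code_seq code_nat) [::])))
    (effective_const D _ code_bool false) (effective_const D _ code_bool true).
  by apply: effective_ext => o Do y; case: bounded_run.
move=> n; split=> [/Ec[y /bounded_run_complete[s hs]]|[s /=]].
  by exists s; rewrite /= hs.
by case E' : bounded_run => [//|y] _; apply/Ec; exists y; exact: bounded_run_sound E'.
Qed.

(** Answering each query by [PZero] simulates the constant oracle under any actual oracle. *)
Lemma computable_effective f : computable f ->
  effective D code_nat code_nat (fun=> f).
Proof.
case=> c hc; exists (subst_query PZero c) => o Do n.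
by apply: run_subst_query (hc n).
Qed.

End BoundedRun.

(** * Reading and writing coded subshifts *)

Definition coded_subshift (K : groupType) (p : marking K) (F : finType)
    (c : binary_coding F) (P : set (K -> F)) : set cantor :=
  (to_cantor (p := p) c @` pullback (gens p) P)%classic.

Definition element (K : groupType) (p : marking K) (n : nat) : K :=
  rho (numbering p n).

Definition read_letter (F : finType) (c : binary_coding F) (o : cantor) (n : nat) :
    option F :=
  let k := coding_length c in
  let s := [seq o (n * k + i) | i <- iota 0 k] in
  [pick a | c a == s :> seq bool].

Lemma read_letterK (K : groupType) (p : marking K) (F : finType)
    (c : binary_coding F) (x : K -> F) n :
  read_letter c (to_cantor (p := p) c (x \o @rho K (gens p))) n =
  Some (x (element p n)).
Proof.
rewrite /read_letter; have k0 := coding_length_gt0 c.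
set a0 := x (element p n).
have -> : [seq to_cantor (p := p) c (x \o @rho K (gens p))
    (n * coding_length c + i) | i <- iota 0 (coding_length c)] = c a0 :> seq bool.
  apply: (@eq_from_nth _ false) => [|i]; rewrite size_map size_iota ?size_tuple //.
  move=> lt_ik; rewrite (nth_map 0) ?size_iota // nth_iota // add0n /to_cantor.
  by rewrite divnMDl // divn_small // addn0 modnMDl modn_small.
case: pickP => [a /eqP E|/(_ a0)]; last by rewrite eqxx.
by congr Some; apply: (@coding_inj _ c); exact: val_inj.
Qed.

Section Letters.
Variable D : set cantor.

Lemma effective_read_letter (F : finType) (c : binary_coding F) b :
  effective D code_nat code_bool b ->
  effective D code_nat (@code_fin (option F)) (fun o => read_letter c (b o)).
Proof.
move=> effb.
apply: (effective_fin_map _ _ (f := fun i o n => b o (n * coding_length c + i))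
  (fun s => [pick a | c a == s :> seq bool])) => i.
have effi := effective_add (effective_mul (effective_id D code_nat)
  (effective_const _ _ code_nat (coding_length c))) (effective_const _ _ code_nat i).
have := effective_if (effective_comp effb effi)
  (effective_const D _ (@code_fin bool) true) (effective_const D _ (@code_fin bool) false).
by apply: effective_ext => o Do n; case: (b o _).
Qed.

(** Passes from letters to bits, locating a bit by division by the coding length. As [x] is a
    function on [K], the last hypothesis includes the agreement of [L] on all indices of one
    element. *)
Lemma medvedev_le_letters (K : groupType) (p : marking K) (F : finType)
    (c : binary_coding F) (P : set (K -> F)) (L : cantor -> nat -> option F) :
  effective D code_nat (@code_fin (option F)) L ->
  (forall o, D o -> exists2 x, P x & forall n, L o n = Some (x (element p n))) ->
  medvedev_le (coded_subshift p c P) D.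
Proof.
move=> effL LP.
have [k Ek] : exists k, coding_length c = k.+1.
  by case: (coding_length c) (coding_length_gt0 c) => // k; exists k.
have effdm := effective_divmod k (effective_id D code_nat).
have [d hd] : effective D code_nat code_bool
    (fun o n => nth false (oapp (fun a => c a : seq bool) [::] (L o (n %/ k.+1)))
       (@inord k (n %% k.+1))).
  apply: (effective_finite (f := fun o n => L o (n %/ k.+1))
    (h := fun a o n => nth false (oapp (fun a => c a : seq bool) [::] a) (@inord k (n %% k.+1)))).
    exact: (effective_comp effL (effective_fst effdm)).
  move=> a; exact: (effective_fin _ (fun i : 'I_k.+1 =>
    nth false (oapp (fun a => c a : seq bool) [::] a) i) (effective_snd effdm)).
exists d => o Do; have [x Px Lx] := LP o Do.
exists (to_cantor (p := p) c (x \o @rho K (gens p))).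
  by exists (x \o @rho K (gens p)) => //; exists x.
move=> n; have := hd o Do n; rewrite Lx inordK ?ltn_pmod //=.
by rewrite /to_cantor /= -Ek.
Qed.

End Letters.

(** * Indices of group elements *)

Section Indices.
Variable D : set cantor.

(** A shortest word for [h] is reduced, since a cancelling pair of neighbours could be deleted. *)
Lemma element_surj (K : groupType) (p : marking K) (h : K) :
  exists n, element p n = h.
Proof.
suff [w <-] : exists w : free_group (gens p), rho w = h.
  by have [g _ gK] := numbering_bij p; exists (g w); rewrite /element gK.
have ex : exists n, `[< exists2 w : seq (gens p * bool), eval_word w = h & size w = n >].
  by have [w wh] := gens_generate p h; exists (size w); apply/asboolP; exists w.
have [n /asboolP[w wh sw] minn] := ex_minnP ex.
suff rw : reduced w by exists (exist _ w rw).
apply/negPn/negP => nred.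
have [u [v [l [m [Ew lm]]]]] : exists u v l m,
    w = u ++ [:: l, m & v] /\ (l.1 == m.1) && (l.2 != m.2).
  move: nred {wh sw}; rewrite /reduced; case: w => // l w; rewrite /sorted.
  elim: w l => //= m w IHw l; rewrite negb_and negbK => /orP[lm|/IHw].
    by exists [::], w, l, m.
  by case=> u [v [l' [m' [-> lm]]]]; exists (l :: u), v, l', m'.
have : eval_word (u ++ v) = h.
  rewrite -wh Ew /eval_word !big_cat !big_cons /=; congr (_ * _)%g.
  rewrite mulgA /eval_letter; case/andP: lm => /eqP->.
  by case: l.2; case: m.2 => // _; rewrite ?mulVg ?mulgV mul1g.
move=> E; suff : size w <= size (u ++ v).
  by rewrite Ew !size_cat /= !addnS ltnNge leqnSn.
by rewrite sw; apply: minn; apply/asboolP; exists (u ++ v).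
Qed.

Lemma effective_numbering (K : groupType) (p : marking K) :
  effective D code_nat (code_seq (@code_fin (gens p * bool)%type))
    (fun _ n => sval (numbering p n)).
Proof.
have [c hc] := computable_effective D (numbering_computable p).
by exists c => o Do n; rewrite -code_seq_fin; exact: hc.
Qed.

Lemma prod_flatten (K : groupType) (L W : Type) (f : L -> seq W) (ev : W -> K) s :
  (\prod_(x <- flatten [seq f l | l <- s]) ev x =
   \prod_(l <- s) \prod_(x <- f l) ev x)%g.
Proof. by rewrite big_flatten big_map. Qed.

Lemma word_number_inj (L : finType) : injective (@word_number L).
Proof.
move=> u v /(can_inj CodeSeq.codeK); apply: inj_map => x y /val_inj.
exact: enum_rank_inj.
Qed.

(** The equation says that a computable word is trivial. The enumeration of trivial words concerns
    its own generating set [S0], so letters of [gens p] are first rewritten over [S0]; the rewriting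
    is chosen on finitely many letters and is therefore a table. With [phi] constantly 1 this
    semidecides equality of indexed elements. *)
Lemma index_relation (G : groupType) (p : marking G) (F : finType) (phi : F -> G) :
  recursively_presented G ->
  exists2 e : nat * F * nat * nat -> bool,
    effective D (code_prod (code_prod (code_prod code_nat (@code_fin F)) code_nat)
      code_nat) code_bool (fun=> e)
    & forall n x m, (element p n * phi x = element p m)%g <-> exists s, e (n, x, m, s).
Proof.
case=> S0 gen0 /(recursively_enumerable_projection D)[e effe eP].
have [spell spellK] := choice gen0.
pose W := (S0 * bool)%type.
pose tau (l : gens p * bool) := spell (eval_letter l).
pose inv (l : W) := spell (eval_letter l)^-1%g.
pose cod := code_prod (code_prod (code_prod code_nat (@code_fin F)) code_nat) code_nat.
pose w (y : nat * F * nat * nat) : seq W :=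
  flatten [seq tau l | l <- sval (numbering p y.1.1.1)] ++ spell (phi y.1.1.2) ++
  flatten [seq inv l | l <- rev (flatten [seq tau l | l <- sval (numbering p y.1.2)])].
have eff1 : effective D cod _ (fun _ y => y.1) := effective_fst (effective_id D _).
have eff11 := effective_fst eff1.
have efft n : effective D cod code_nat n -> effective D cod
    (code_seq (@code_fin W)) (fun o y => flatten [seq tau l | l <- sval (numbering p (n o y))]).
  by move=> effn; apply: effective_flatten_map; exact: effective_comp (effective_numbering p) effn.
have effw : effective D cod (code_seq (@code_fin W)) (fun=> w).
  apply: effective_cat; first exact: efft (effective_fst eff11).
  apply: effective_cat.
    exact: (effective_fin _ (fun x => spell (phi x)) (effective_snd eff11)).
  apply: effective_flatten_map; rewrite /rev.
  apply: effective_catrev (effective_const _ _ _ _).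
  exact: efft (effective_snd eff1).
have effn : effective D cod code_nat (fun _ y => word_number (w y)).
  by have [c hc] := effw; exists c => o Do y; rewrite code_seq_fin; exact: hc.
exists (fun y => e (word_number (w y), y.2)).
  apply: (effective_comp effe); apply: effective_pair effn _.
  exact: effective_snd (effective_id D _).
move=> n x m.
have taus k : eval_word (flatten [seq tau l | l <- sval (numbering p k)]) = element p k.
  by rewrite /eval_word prod_flatten; apply: eq_bigr => l _; exact: spellK.
have invs (u : seq W) : eval_word (flatten [seq inv l | l <- rev u]) = (eval_word u)^-1%g.
  rewrite /eval_word prod_flatten; elim: u => [|l u IHu].
    by rewrite !big_nil invg1.
  rewrite rev_cons -cats1 big_cat big_seq1 IHu big_cons invgM.
  by congr (_ * _)%g; exact: spellK.
have E s : eval_word (w (n, x, m, s)) = (element p n * phi x * (element p m)^-1)%g.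
  rewrite -!taus -invs -[phi x]spellK /w /eval_word !big_cat /= mulgA; congr (_ * _ * _)%g.
transitivity (eval_word (w (n, x, m, 0)) = 1%g).
  rewrite E; split=> [->|/eqP]; first by rewrite mulgV.
  by rewrite divg_eq1 => /eqP.
transitivity (exists s, e (word_number (w (n, x, m, 0)), s)); last by split.
rewrite -eP; split=> [w1|[u u1 wu]]; first by exists (w (n, x, m, 0)).
by rewrite -u1; congr eval_word; exact: word_number_inj.
Qed.

Lemma effective_mul_index (G : groupType) (p : marking G) (F : finType) (phi : F -> G) :
  recursively_presented G ->
  exists2 mul, effective D (code_prod code_nat (@code_fin F)) code_nat mul
    & forall o, D o -> forall y,
        element p (mul o y) = (element p y.1 * phi y.2)%g.
Proof.
move=> /(index_relation p phi)[e effe eP].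
have effn i : effective D
    (code_prod (code_prod code_nat (@code_fin F)) (code_seq code_nat)) code_nat
    (fun _ y => nth 0 y.2 i).
  by apply: effective_nth; exact: effective_snd (effective_id D _).
(* The search is for a list holding an index and a certificate. Lists are coded bijectively by
   [CodeSeq], whereas the coding of pairs misses 0. *)
have [||||f efff fP] := @effective_search D _ _ (code_prod code_nat (@code_fin F))
    (code_seq code_nat) CodeSeq.decode (fun _ y => e (y.1, nth 0 y.2 0, nth 0 y.2 1)).
- by move=> n; rewrite code_seq_map map_id CodeSeq.decodeK.
- by move=> s; rewrite code_seq_map map_id CodeSeq.codeK.
- apply: (effective_comp effe); apply: effective_pair (effn 1).
  by apply: effective_pair (effn 0); exact: effective_fst (effective_id D _).
- move=> o Do [n x]; have [m mE] := element_surj p (element p n * phi x)%g.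
  by have [s es] := (eP n x m).1 (esym mE); exists [:: m; s].
exists (fun o y => nth 0 (f o y) 0); first exact: effective_nth.
by move=> o Do [n x]; apply/esym/eP; exists (nth 0 (f o (n, x)) 1); exact: fP.
Qed.

End Indices.

(** * Following an encoded quasi-isometry *)

(** A symbol of [QI] only records moves by elements of [T], so formal inverses must be
    eliminated. *)
Lemma symmetric_generating_set_spells (K : groupType) (T : {fset K}) :
  symmetric_generating_set T ->
  forall h, exists v : seq T, (\prod_(t <- v) val t)%g = h.
Proof.
case=> genT _ invT h; have [w <-] := genT h.
exists [seq (if l.2 then FSetSub (invT _ (valP l.1)) else l.1) | l : (T * bool)%type <- w].
by rewrite big_map; apply: eq_bigr => -[t []].
Qed.

Section Walk.
Variables (G H : groupType) (S : {fset G}) (T : {fset H}) (C N : nat).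
Variables (pG : marking G) (pH : marking H) (D : set cantor).
Variable l : cantor -> nat -> option (qi_alphabet S T C N).

Hypothesis symT : symmetric_generating_set T.
Hypothesis N_gt0 : 0 < N.
Hypothesis recG : recursively_presented G.
Hypothesis effl :
  effective D code_nat (@code_fin (option (qi_alphabet S T C N))) l.

(** The reader [l] is kept abstract because the walk is used twice: on the B-part of a configuration
    of QI[X], and on the even bits of a join. *)
Definition reads o (q : G -> qi_alphabet S T C N) :=
  forall n, l o n = Some (q (element pG n)).

Hypothesis l_encodes : forall o, D o ->
  exists q f iota, encodes q f iota /\ reads o q.

Let J := 'I_N.
Let tuples := option ((2 * C).-tuple S).
Let code_state := code_prod code_nat (@code_fin J).

(** The starting cell depends on the oracle alone, whence an effective function on [unit]. The
    search halts because the cell of [f 1] and [iota 1] is occupied. *)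
Lemma effective_start : exists2 st : cantor -> nat * J,
  effective D (fun _ : unit => 0) code_state (fun o _ => st o)
  & forall o q, D o -> reads o q -> q (element pG (st o).1) (st o).2 != None.
Proof.
pose pick_coord (b : option (qi_alphabet S T C N)) : J :=
  if b is Some b' then odflt (Ordinal N_gt0) [pick i | b' i != None]
  else Ordinal N_gt0.
pose occupied (b : option (qi_alphabet S T C N)) :=
  if b is Some b' then b' (pick_coord b) != None else false.
have effl2 : effective D (code_prod (fun _ : unit => 0) code_nat)
    (@code_fin (option (qi_alphabet S T C N))) (fun o y => l o y.2).
  exact: effective_comp effl (effective_snd (effective_id D _)).
have [||||n effn nP] := @effective_search D _ _ (fun _ : unit => 0)
    code_nat id (fun o y => occupied (l o y.2)).
- by [].
- by [].
- exact: effective_fin effl2.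
- move=> o Do []; have [q [f [iota [[_ bij _] lq]]]] := l_encodes Do.
  have [n nE] := element_surj pG (f 1%g).
  exists n; rewrite /occupied /pick_coord /= lq nE.
  case: pickP => //= /(_ (iota 1%g))/negbT/negP; case.
  by have [fbij _ _] := bij; exact: (fbij 1%g I).
exists (fun o => (n o tt, pick_coord (l o (n o tt)))).
  apply: (effective_ext (f := fun o a => (n o a, pick_coord (l o (n o a))))).
    by move=> o Do [].
  apply: (effective_pair effn); apply: effective_fin.
  exact: effective_comp effl effn.
by move=> o q Do lq; have := nP o Do tt; rewrite /= lq.
Qed.

(** The walk is computed from the oracle only, while [h0] depends on the pair [(f, iota)]. All walks
    share one start, so a single [h0] serves every [n]; this is what makes the letters met along
    them a translate of one configuration. *)
Lemma effective_position : exists2 pos : cantor -> nat -> nat * J,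
  effective D code_nat code_state pos
  & forall o q f iota, D o -> encodes q f iota -> reads o q ->
    exists h0, forall n,
      element pG (pos o n).1 = f (h0 * element pH n)%g /\
      (pos o n).2 = iota (h0 * element pH n)%g.
Proof.
have [st effst stP] := effective_start.
pose phi (w : tuples) : G := if w is Some w' then (\prod_(s <- w') val s)%g else 1%g.
have [mul effmul mulP] := effective_mul_index D pG phi recG.
(* The default values are never met: a walk from an occupied cell stays on occupied cells. *)
pose move (b : option (qi_alphabet S T C N)) (i : J) (t : T) : tuples * J :=
  if b is Some b' then if b' i is Some m then (Some (m t).1, (m t).2)
  else (None, i) else (None, i).
pose step o (y : nat * J) (t : T) : nat * J :=
  let m := move (l o y.1) y.2 t in (mul o (y.1, m.1), m.2).
have [spell spellK] := choice (symmetric_generating_set_spells symT).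
pose path n : seq T := flatten [seq spell (eval_letter x) | x <- sval (numbering pH n)].
exists (fun o n => foldl (step o) (st o) (path n)).
  have effy : effective D (code_prod code_nat (code_prod code_state (@code_fin T)))
      code_state (fun _ y => y.2.1).
    by apply: effective_fst; apply: effective_snd; exact: effective_id.
  have efft : effective D (code_prod code_nat (code_prod code_state (@code_fin T)))
      (@code_fin T) (fun _ y => y.2.2).
    by do 2! apply: effective_snd; exact: effective_id.
  have effm : effective D (code_prod code_nat (code_prod code_state (@code_fin T)))
      (code_prod (@code_fin tuples) (@code_fin J))
      (fun o y => move (l o y.2.1.1) y.2.1.2 y.2.2).
    apply: (effective_finite (h := fun b o y => move b y.2.1.2 y.2.2)
      (effective_comp effl (effective_fst effy))) => b.
    apply: (effective_finite (h := fun i o y => move b i y.2.2) (effective_snd effy)) => i.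
    exact: (effective_fin _ (fun t => move b i t) efft).
  have effstep : effective D (code_prod code_nat (code_prod code_state (@code_fin T)))
      code_state (fun o y => step o y.2.1 y.2.2).
    apply: effective_pair; last exact: effective_snd effm.
    apply: (effective_comp effmul); apply: effective_pair; first exact: effective_fst effy.
    exact: effective_fst effm.
  apply: (effective_foldl (st := fun o y => step o y.2.1 y.2.2) _ _ effstep).
    by apply: effective_flatten_map; exact: effective_numbering.
  exact: effective_comp effst (effective_const _ _ (fun _ : unit => 0) tt).
move=> o q f iota Do [_ [_ inj surj] qE] lq.
have [h0 _ [fh0 iotah0]] :=
  surj (element pG (st o).1, (st o).2) (stP o q Do lq).
exists h0 => n.
have -> : element pH n = (\prod_(t <- path n) val t)%g.
  by rewrite prod_flatten; apply: eq_bigr => x _; rewrite spellK.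
elim: (path n) h0 (st o) fh0 iotah0 => [|t v IHv] h y fh ioh /=.
  by rewrite big_nil mulg1.
rewrite big_cons mulgA; have [b [qb wb ib]] := qE h t.
apply: IHv; rewrite /step lq /= -fh -ioh /= qb /=; last exact: esym ib.
by rewrite mulP //= wb -fh mulgA mulgV mul1g.
Qed.

End Walk.

(** * Reductions between QI[X], QI and X *)

Section Enriched.
Variables (G H : groupType) (S : {fset G}) (T : {fset H}) (C N : nat) (A : finType).
Variables (X : set (H -> A)) (pG : marking G) (pH : marking H).
Variables (cQI : binary_coding (qi_alphabet S T C N))
  (cQIX : binary_coding (qi_enriched_alphabet S T C N A)) (cX : binary_coding A).

Hypothesis symT : symmetric_generating_set T.
Hypothesis N_gt0 : 0 < N.
Hypothesis recG : recursively_presented G.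
Hypothesis subX : subshift X.

Let QIs := coded_subshift pG cQI (QI S T C N).
Let QIXs := coded_subshift pG cQIX (QI_enriched S T C N X).
Let Xs := coded_subshift pH cX X.

Let strip (b : qi_enriched_alphabet S T C N A) : qi_alphabet S T C N :=
  [ffun i => omap snd (b i)].

Let read_stripped (o : cantor) n := omap strip (read_letter cQIX o n).

Let effective_oracle D : effective D code_nat code_bool (fun o n => o n).
Proof. exact: effective_query (effective_id D _). Qed.

Let effective_read_stripped D :
  effective D code_nat (@code_fin (option (qi_alphabet S T C N))) read_stripped.
Proof.
exact: effective_fin _ (omap strip) (effective_read_letter cQIX (effective_oracle D)).
Qed.

Lemma medvedev_le_QI_enriched : medvedev_le QIs QIXs.
Proof.
apply: medvedev_le_letters (effective_read_stripped _) _.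
move=> _ [_ [q [QIq _] <-] <-]; exists (B_part q) => // n.
by rewrite /read_stripped read_letterK.
Qed.

Lemma medvedev_le_X_enriched : medvedev_le Xs QIXs.
Proof.
have [|pos effpos posP] := effective_position pH symT N_gt0 recG
    (effective_read_stripped QIXs) (pG := pG).
  move=> _ [_ [q [[f [iota enc]] _] <-] <-]; exists (B_part q), f, iota; split=> // n.
  by rewrite /read_stripped read_letterK.
pose label (b : option (qi_enriched_alphabet S T C N A)) (i : 'I_N) : option A :=
  obind (fun b' : qi_enriched_alphabet S T C N A => omap fst (b' i)) b.
have effx : effective QIXs code_nat (@code_fin (option A))
    (fun o n => label (read_letter cQIX o (pos o n).1) (pos o n).2).
  have effb := effective_comp (effective_read_letter cQIX (effective_oracle QIXs))
    (effective_fst effpos).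
  apply: (effective_finite (h := fun b o n => label b (pos o n).2) effb) => b.
  exact: effective_fin _ (label b) (effective_snd effpos).
apply: medvedev_le_letters effx _.
move=> o Do; have [_ [q [_ [f [iota [enc [x Xx qx]]]]] <-] oE] := Do.
have lq : reads pG read_stripped o (B_part q).
  by move=> n; rewrite /read_stripped -oE read_letterK.
have [h0 h0P] := posP _ _ _ _ Do enc lq.
(* At an index of [h] the walk reads [x (h0 * h)]. *)
exists (shift_by h0^-1%g x); first exact: subX.2.
move=> n; have [posn1 posn2] := h0P n.
by rewrite -{1}oE read_letterK /= posn1 posn2 qx /shift_by invgK.
Qed.

Lemma medvedev_ge_QI_enriched : medvedev_le QIXs (medvedev_join QIs Xs).
Proof.
set D := medvedev_join QIs Xs.
pose lQ (o : cantor) n := read_letter cQI (fun m => o m.*2) n.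
pose lX (o : cantor) n := read_letter cX (fun m => o m.*2.+1) n.
have effdouble : effective D code_nat code_nat (fun _ n => n.*2).
  exists code_double => o Do n; exact: run_double.
have efflQ : effective D code_nat (@code_fin (option (qi_alphabet S T C N))) lQ.
  apply: (effective_read_letter cQI (b := fun (o : cantor) m => o m.*2)).
  exact: effective_query effdouble.
have efflX : effective D code_nat (@code_fin (option A)) lX.
  apply: (effective_read_letter cX (b := fun (o : cantor) m => o m.*2.+1)).
  exact: effective_query (effective_succ effdouble).
have lQP o q y : o = interleave (to_cantor (p := pG) cQI (q \o @rho G (gens pG))) y ->
    reads pG lQ o q.
  move=> -> n; rewrite /lQ -(read_letterK pG cQI q); congr read_letter.
  by apply/funext => m; rewrite /interleave odd_double doubleK.
have lXP o x y n : o = interleave y (to_cantor (p := pH) cX (x \o @rho H (gens pH))) ->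
    lX o n = Some (x (element pH n)).
  move=> ->; rewrite /lX -(read_letterK pH cX x); congr read_letter.
  by apply/funext => m; rewrite /interleave /= odd_double /= uphalf_double.
have [|pos effpos posP] := effective_position pH symT N_gt0 recG efflQ (pG := pG).
  move=> o [_ [y [[_ [q [f [iota enc]] <-] <-] _ oE]]].
  by exists q, f, iota; split=> //; exact: lQP oE.
have [e effe eP] := index_relation D pG (fun _ : unit => 1%g) recG.
have {}eP n m : element pG n = element pG m <-> exists s, e (n, tt, m, s).
  by rewrite -eP mulg1.
pose empty (b : option (qi_alphabet S T C N)) i : bool :=
  if b is Some b' then b' i == None else true.
(* For each coordinate [i], [F i] sends an index of [g] to an index in [H] whose walk ends at
   [(g, i)], provided that this cell is occupied. *)
have /choice[F FP] (i : 'I_N) : exists Fi, effective D code_nat code_nat Fi /\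
    forall o, D o -> forall n, ~~ empty (lQ o n) i ->
      element pG (pos o (Fi o n)).1 = element pG n /\ (pos o (Fi o n)).2 = i.
  have effm j : effective D (code_prod code_nat (code_seq code_nat)) code_nat
      (fun _ y => nth 0 y.2 j).
    by apply: effective_nth; exact: effective_snd (effective_id D _).
  have effn : effective D (code_prod code_nat (code_seq code_nat)) code_nat
      (fun _ y => y.1) := effective_fst (effective_id D _).
  have effp := effective_comp effpos (effm 0).
  (* On an empty cell every candidate is accepted, which keeps the search total. *)
  have [||||f efff fP] := @effective_search D _ _ code_nat (code_seq code_nat)
      CodeSeq.decode (fun o y => if empty (lQ o y.1) i then true else
        if (pos o (nth 0 y.2 0)).2 == i
        then e (y.1, tt, (pos o (nth 0 y.2 0)).1, nth 0 y.2 1) else false).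
  - by move=> n; rewrite code_seq_map map_id CodeSeq.decodeK.
  - by move=> s; rewrite code_seq_map map_id CodeSeq.codeK.
  - apply: effective_if (effective_const _ _ _ _) _.
      exact: effective_fin _ (empty ^~ i) (effective_comp efflQ effn).
    apply: effective_if (effective_const _ _ _ _).
      exact: effective_fin _ (fun j => j == i) (effective_snd effp).
    apply: (effective_comp effe); apply: effective_pair (effm 1).
    apply: effective_pair (effective_fst effp).
    exact: effective_pair effn (effective_const _ _ _ _).
  - move=> o Do n.
    have [_ [y [[_ [q [f [iota enc]] <-] <-] _ oE]]] := Do.
    have lq := lQP _ _ _ oE; have [h0 h0P] := posP _ _ _ _ Do enc lq.
    rewrite /= lq /=; case: eqP => [_|/eqP qi]; first by exists [::].
    have [_ [_ _ surj] _] := enc; have [h _ [fh ih]] := surj (element pG n, i) qi.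
    have [m mE] := element_surj pH (h0^-1 * h)%g.
    have [pos1 pos2] := h0P m; move: pos1 pos2.
    rewrite mE mulgA mulgV mul1g fh ih => pos1 pos2.
    have [s es] := (eP _ _).1 (esym pos1).
    by exists [:: m; s]; rewrite /= pos2 eqxx.
  exists (fun o n => nth 0 (f o n) 0); split; first exact: effective_nth.
  move=> o Do n nempty; have := fP o Do n; rewrite /= (negbTE nempty).
  case: eqP => // <- es; split=> //; apply/esym/eP; by exists (nth 0 (f o n) 1).
(* On a [*] cell the index found by [F i] is meaningless, and [glue] discards the letter read
   there. *)
pose glue (b : option (qi_alphabet S T C N)) (s : seq (option A)) :
    option (qi_enriched_alphabet S T C N A) :=
  omap (fun b' : qi_alphabet S T C N => [ffun i : 'I_N =>
    if b' i is Some m then omap (fun a => (a, m)) (nth None s i) else None]) b.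
have effglue : effective D code_nat (@code_fin (option (qi_enriched_alphabet S T C N A)))
    (fun o n => glue (lQ o n) [seq lX o (F i o n) | i <- enum 'I_N]).
  apply: (effective_finite (h := fun b o n =>
    glue b [seq lX o (F i o n) | i <- enum 'I_N]) efflQ) => b.
  apply: (effective_fin_map _ _ (f := fun i o n => lX o (F i o n)) (glue b)) => i.
  exact: effective_comp efflX (FP i).1.
apply: medvedev_le_letters effglue _.
move=> o Do; have [_ [_ [[_ [q [f [iota enc]] <-] <-] [_ [x Xx <-] <-] oE]]] := Do.
have lq := lQP _ _ _ oE; have [h0 h0P] := posP _ _ _ _ Do enc lq.
have [_ [fun_f inj_f surj_f] _] := enc.
pose pre g i := xget 1%g [set h | (f h, iota h) = (g, i)]%classic.
have preK h : pre (f h) (iota h) = h.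
  rewrite /pre; case: xgetP => [h' _ /= E|/(_ h)]; last by case.
  by apply: inj_f => //; rewrite in_setT.
(* The cell of [h] is reached by the walk along [h0^-1 * h], so the letter written there is
   [x (h0^-1 * h)]. *)
pose x' := shift_by h0 x.
pose q' g : qi_enriched_alphabet S T C N A :=
  [ffun i => omap (fun m => (x' (pre g i), m)) (q g i)].
have Bq' : B_part q' = q.
  by apply/funext => g; apply/ffunP => i; rewrite !ffunE; case: (q g i).
exists q'.
  split; first by rewrite Bq'; exists f, iota.
  exists f, iota; rewrite Bq'; split=> //; exists x'; first exact: subX.2.
  by move=> h; rewrite ffunE preK; have := fun_f h I; rewrite /=; case: (q _ _).
move=> n; rewrite lq /=; congr Some; apply/ffunP => i; rewrite !ffunE.
case qi: (q (element pG n) i) => [m|//] /=.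
rewrite (nth_map i) ?size_enum_ord // nth_ord_enum.
have [|] := (FP i).2 o Do n; first by rewrite lq /= qi.
have [pos1 pos2] := h0P (F i o n).
rewrite pos1 pos2 => e1 e2; have := preK (h0 * element pH (F i o n))%g.
rewrite e1 e2 => ->; rewrite (lXP _ _ _ _ oE) /= /x' /shift_by.
by rewrite mulgA mulVg mul1g.
Qed.

End Enriched.

Theorem lemma4p19 (G H : groupType) (S : {fset G}) (T : {fset H}) (C N : nat)
    (A : finType) (X : set (H -> A))
    (pG : marking G) (pH : marking H)
    (cQI : binary_coding (qi_alphabet S T C N))
    (cQIX : binary_coding (qi_enriched_alphabet S T C N A))
    (cX : binary_coding A) :
  symmetric_generating_set S -> symmetric_generating_set T ->
  (0 < C)%N -> (0 < N)%N ->
  recursively_presented G ->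
  subshift X ->
  (subshift_degree pG cQIX (QI_enriched S T C N X) =
   subshift_degree pG cQI (QI S T C N) `|` subshift_degree pH cX X)%O.
Proof.
move=> _ symT _ N_gt0 recG subX; apply: Order.POrderTheory.le_anti.
rewrite Order.JoinTheory.leUx; apply/and3P; split; last 2 first.
- exact/degree_leP/medvedev_le_QI_enriched.
- exact/degree_leP/medvedev_le_X_enriched.
apply: (Order.POrderTheory.le_trans
  (y := degree (medvedev_join (coded_subshift pG cQI (QI S T C N)) (coded_subshift pH cX X)))).
  exact/degree_leP/medvedev_ge_QI_enriched.
(* The join of degrees is built from chosen representatives; the interleaving of the actual sets is
   compared with it through the least upper bound property. *)
rewrite -[leRHS]degreeK; apply/degree_leP/medvedev_join_lub.
split; apply/degree_leP; rewrite degreeK.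
  exact: (Order.JoinTheory.leUl (subshift_degree pG cQI (QI S T C N))).
exact: (Order.JoinTheory.leUr (subshift_degree pH cX X)).
Qed.
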